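(* Let $u>0$ be real. (i) If $u=\frac{p}{q}$ with $p,q$ positive integers such that $p^*+q^*$ is odd, then $E_u$ contains an interval (of positive length), and $E_u$ is the closure of its interior. (ii) If $u=\frac{p}{q}$ with $p,q$ positive integers such that $p^*$ and $q^*$ are both odd, then $E_u$ has one-dimensional Lebesgue measure zero and the Hausdorff dimension of $E_u$ is $<1$. (iii) If $u$ is irrational, then $E_u$ has one-dimensional Lebesgue measure zero.
   Context: For real $u>0$, $$E_u=\left\{\sum_{j=1}^\infty(\varepsilon_j+u\varepsilon_j')4^{-j} : (\varepsilon_j,\varepsilon_j')\in\{0,1\}^2\right\}=\left\{\sum_{j=1}^\infty a_j4^{-j} : a_j\in\{0,1,u,1+u\}\right\}\subset\mathbb{R}.$$ For a positive integer $n$, $n^*\in\{1,2,3\}$ denotes the first nonzero digit, starting from the right, in the base $4$ expansion of $n$; that is, $n^*\equiv n4^{-j^*} \pmod 4$ where $j^*=\sup\{j : 4^j \text{ divides } n\}$. *)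

(* Defs.v *)
From mathcomp Require Import all_boot all_order all_algebra.
From mathcomp Require Import all_classical all_reals all_analysis.

Set Implicit Arguments.
Unset Strict Implicit.
Unset Printing Implicit Defensive.

Import Order.TTheory GRing.Theory Num.Theory.
Import numFieldNormedType.Exports.

Local Open Scope classical_set_scope.
Local Open Scope ring_scope.

(* Indices are shifted: the term j here is the term j + 1 of a sum over j >= 1. *)
Definition E (R : realType) (u : R) : set R :=
  [set x | exists e e' : nat -> bool,
     series (fun j => ((e j)%:R + u * (e' j)%:R) * 4^-1 ^+ j.+1) @ \oo --> x].

Lemma E_digits (R : realType) (u : R) :
  E u = [set x | exists2 a : nat -> R,
           (forall j, a j \in [:: 0; 1; u; 1 + u]) &
           series (fun j => a j * 4^-1 ^+ j.+1) @ \oo --> x].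
Proof.
apply/seteqP; split=> x /= => [[e [e' ex]]|[a ha ax]].
  exists (fun j => (e j)%:R + u * (e' j)%:R) => // j.
  case: (e j) (e' j) => -[];
    by rewrite !inE ?mulr0 ?mulr1 ?addr0 ?add0r eqxx ?orbT.
have /choice[f fa] j : exists b : bool * bool, a j = b.1%:R + u * b.2%:R.
  move: (ha j); rewrite !inE => /or4P[] /eqP ->.
  - by exists (false, false); rewrite mulr0 addr0.
  - by exists (true, false); rewrite mulr0 addr0.
  - by exists (false, true); rewrite mulr1 add0r.
  - by exists (true, true); rewrite mulr1.
exists (fun j => (f j).1), (fun j => (f j).2).
by under eq_fun do rewrite -fa.
Qed.

(* For n > 0, 4 ^ j %| n forces j < n, so the bound on j loses nothing. *)
Definition four_val (n : nat) : nat := (\max_(j < n | 4 ^ j %| n) j)%N.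

Definition last_digit4 (n : nat) : nat := (n %/ 4 ^ four_val n %% 4)%N.

Definition diam (R : realType) (U : set R) : \bar R :=
  ereal_sup [set (`|x.1 - x.2|)%:E | x in U `*` U].

(* diam(U)^s, with value 0 on the empty set for every s, including s = 0
   (for s = 0 a singleton counts for 0^0 = 1, by the convention of poweR). *)
Definition diam_pow (R : realType) (s : R) (U : set R) : \bar R :=
  if U == set0 then 0%E else poweR (diam U) s.

Definition delta_cover (R : realType) (d : R) (A : set R) : set (nat -> set R) :=
  [set U | A `<=` \bigcup_k U k /\ forall k, (diam (U k) <= d%:E)%E].

Definition hausdorff_pre (R : realType) (s d : R) (A : set R) : \bar R :=
  ereal_inf [set (\sum_(k <oo) diam_pow s (U k))%E | U in delta_cover d A].

Definition hausdorff_measure (R : realType) (s : R) (A : set R) : \bar R :=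
  ereal_sup [set hausdorff_pre s d A | d in [set d : R | 0 < d]].

Definition hausdorff_dim (R : realType) (A : set R) : \bar R :=
  ereal_inf [set s%:E |
    s in [set s : R | 0 <= s /\ hausdorff_measure s A = 0%E]].

(* Main.v *)
(* Let S_k be the multiset of the 4^k integer parts sum_(j < k) d_j 4^j with
   digits d_j in {0, 1, u, 1 + u}; then 4^k E = S_k + E, and E is a compact
   subset of [0, (1 + u) / 3].

   (i) Since E_{4u} = E_u `|` (E_u + u), whether E_u contains an interval
   depends only on u up to powers of 4, so one may take u = 2 r / s with r, s
   odd.  The digits times s are then a complete residue system modulo 4, whence
   E + (1/s)Z is dense; finitely many translates of a closed set without
   interior leave gaps of a uniform size in every unit interval, so E contains
   an interval, and by self-similarity E is the closure of its interior.

   Measure zero.  If E contains no interval and the number of points of S_k in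
   an interval of fixed length is bounded in k, the same gaps occur in E at all
   scales, so E has measure zero and dimension < 1.  The bound on S_k holds for
   u rational because S_k lies in a lattice, and whenever E has positive measure
   because 4^k E has measure 4^k |E|.

   No interval.  Suppose that 1/2 and u/2 are not differences of points of the
   S_k, which is the case for u irrational and for u = p / q with p, q odd, and
   that E contains an interval.  Then E has positive measure, the translates
   s + E, s in S_K, overlap in null sets, and G = sum_(s in S_K) 1_E(. - s) is 1
   almost everywhere on 4^K E, which contains long intervals.  Write K = k + n,
   N = 4^n, let T be the translation by its index, and convolve G with S_n / 2.
   The second difference (1 - T_{1/2})(1 - T_{u/2}) annihilates the resulting
   constant, but since S_n + S_n / 2 telescopes it also yields
   sum_(s in S_k) (1 - T_{N/2})(1 - T_{uN/2}) 1_E(. - N s).  For n large the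
   sets E + N v, with v in S_k + {0, 1/2, u/2, (1+u)/2}, are disjoint for
   distinct v, so near N v_0 with v_0 in S_k this sum is positive by the
   hypothesis on 1/2 and u/2: a contradiction. *)
Require Import Defs.
From mathcomp Require Import all_boot all_order all_algebra.
From mathcomp Require Import all_classical all_reals all_analysis.
From mathcomp Require Import measurable_realfun ring lra zify.

Set Implicit Arguments.
Unset Strict Implicit.
Unset Printing Implicit Defensive.

Import Order.TTheory GRing.Theory Num.Theory.
Import numFieldNormedType.Exports.

Local Open Scope classical_set_scope.
Local Open Scope ring_scope.

(** * The self-similar structure of E *)

Lemma quarter_itv (R : realType) : 0 <= (4^-1 : R) < 1.
Proof. by rewrite invr_ge0 ler0n invf_lt1 ?ltr1n. Qed.

Lemma lt_geometric (R : realType) (C q e : R) : 0 <= q < 1 -> 0 < e ->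
  exists n, C * q ^+ n < e.
Proof.
move=> /andP[q0 q1] e0.
have : (fun n => C * q ^+ n) @ \oo --> (0 : R).
  rewrite -[X in _ --> X](mulr0 C); apply: cvgMr; apply: cvg_expr.
  by rewrite ger0_norm.
move=> /cvgrPdist_lt/(_ e e0)[n _ /(_ n (leqnn n))] /=.
by rewrite sub0r normrN => H; exists n; apply: le_lt_trans H; exact: ler_norm.
Qed.

Lemma cvg_expr4V (R : realType) : (fun n => 4^-1 ^+ n : R) @ \oo --> (0 : R).
Proof. by apply: cvg_expr; rewrite ger0_norm ?invr_ge0// invf_lt1// ltr1n. Qed.

Definition digits (R : realType) (u : R) : seq R := [:: 0; 1; u; 1 + u].

Lemma digitsP (R : realType) (u d : R) :
  d \in digits u <-> exists b b' : bool, d = b%:R + u * b'%:R.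
Proof.
split=> [|[b [b' ->]]].
  rewrite !inE => /or4P[] /eqP ->.
  - by exists false, false; rewrite mulr0 addr0.
  - by exists true, false; rewrite mulr0 addr0.
  - by exists false, true; rewrite mulr1 add0r.
  - by exists true, true; rewrite mulr1.
by case: b b' => -[]; rewrite !inE ?mulr0 ?mulr1 ?addr0 ?add0r eqxx ?orbT.
Qed.

Lemma digits_itv (R : realType) (u d : R) : 0 < u -> d \in digits u ->
  0 <= d <= 1 + u.
Proof. by move=> u0; rewrite !inE => /or4P[] /eqP ->; apply/andP; split; lra. Qed.

Lemma series_base4S (R : realType) (a : nat -> R) n :
  series (fun j => a j * 4^-1 ^+ j.+1) n.+1 =
  4^-1 * (a 0%N + series (fun j => a j.+1 * 4^-1 ^+ j.+1) n).
Proof.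
rewrite /series /= big_nat_recl //= expr1 mulrDr mulrC; congr (_ + _).
by rewrite mulr_sumr; apply: eq_bigr => i _; rewrite [in LHS]exprS; ring.
Qed.

Lemma cvg_base4S (R : realType) (a : nat -> R) (l : R) :
  series (fun j => a j.+1 * 4^-1 ^+ j.+1) @ \oo --> l <->
  series (fun j => a j * 4^-1 ^+ j.+1) @ \oo --> 4^-1 * (a 0%N + l).
Proof.
rewrite -[X in _ <-> X]cvg_shiftS /=.
under [X in _ <-> (X @ _ --> _)]eq_fun do rewrite series_base4S.
set s := series _; split=> sl.
  by apply: cvgMr; apply: cvgD; [exact: cvg_cst|].
rewrite (_ : s = (fun n => 4 * (4^-1 * (a 0%N + s n)) - a 0%N)); last first.
  by apply/funext => n; field.
rewrite (_ : l = 4 * (4^-1 * (a 0%N + l)) - a 0%N); last by field.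
by apply: cvgB; [exact: cvgMr|exact: cvg_cst].
Qed.

Lemma E_cons (R : realType) (u d y : R) :
  d \in digits u -> E u y -> E u (4^-1 * (d + y)).
Proof.
move=> /digitsP[b [b' ->]] [e [e' ey]].
pose cons (b : bool) (f : nat -> bool) n := if n is m.+1 then f m else b.
exists (cons b e), (cons b' e').
exact/(cvg_base4S (fun j => (cons b e j)%:R + u * (cons b' e' j)%:R)).
Qed.

Lemma E_uncons (R : realType) (u x : R) : E u x ->
  exists2 d, d \in digits u & E u (4 * x - d).
Proof.
move=> [e [e' ex]]; exists ((e 0%N)%:R + u * (e' 0%N)%:R).
  by apply/digitsP; do 2!eexists.
exists (e \o S), (e' \o S).
apply/(cvg_base4S (fun j => (e j)%:R + u * (e' j)%:R)).
by move: ex; congr (_ --> _); field.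
Qed.

(** The value of the series with every digit equal to [1 + u], since the powers of 1/4 sum to
    1/3. *)
Definition maxE (R : realType) (u : R) : R := (1 + u) / 3.

Lemma maxE_gt0 (R : realType) (u : R) : 0 < u -> 0 < maxE u.
Proof. by move=> u0; rewrite /maxE; lra. Qed.

Lemma E_bound (R : realType) (u x : R) : 0 < u -> E u x -> 0 <= x <= maxE u.
Proof.
move=> u0 [e [e' ex]].
pose a j := (e j)%:R + u * (e' j)%:R.
have aP j : 0 <= a j <= 1 + u.
  by apply: digits_itv => //; apply/digitsP; do 2!eexists.
have sP n (b : nat -> R) : (forall j, 0 <= b j <= 1 + u) ->
    0 <= series (fun j => b j * 4^-1 ^+ j.+1) n <= maxE u.
  elim: n b => [|n IH] b bP.
    by rewrite /series/= big_geq// lexx /maxE; lra.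
  rewrite series_base4S; have := IH _ (fun j => bP j.+1); have := bP 0%N.
  by rewrite /maxE; lra.
suff : `[0, maxE u]%classic x by rewrite /= in_itv.
apply: (@closed_cvg _ _ _ _ _ _ (@itv_closed _ R 0 (maxE u)) _ x ex).
by near=> n; rewrite /= in_itv; exact: sP.
Unshelve. all: by end_near. Qed.

(** Stage [k] of the iterated function system with maps y -> (d + y) / 4, started from the interval
    [[0, maxE u]]. The stages are closed and nested. *)
Fixpoint approxE (R : realType) (u : R) (k : nat) : set R :=
  if k is k'.+1 then [set x | exists2 d, d \in digits u & approxE u k' (4 * x - d)]
  else `[0, maxE u]%classic.

Lemma closed_approxE (R : realType) (u : R) k : closed (approxE u k).
Proof.
elim: k => [|k IH] /=; first exact: itv_closed.
rewrite (_ : mkset _ = \bigcup_(d in [set` digits u])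
  ((fun x => 4 * x - d) @^-1` approxE u k)); last first.
  by apply/seteqP; split=> x [d] ? ?; exists d.
apply: closed_bigcup; first exact: finite_seq.
move=> d _; apply: preimage_closed => // x _.
apply: cvgB; last exact: cvg_cst.
by apply: cvgMr; exact: cvg_id.
Qed.

Lemma approxES (R : realType) (u : R) k : 0 < u ->
  approxE u k.+1 `<=` approxE u k.
Proof.
move=> u0; elim: k => [|k IH] x /= [d dd].
  by have := digits_itv u0 dd; rewrite /= !in_itv /= /maxE; lra.
by move=> [d' dd' ?]; exists d => //; apply: IH; exists d'.
Qed.

Lemma approxE_le (R : realType) (u : R) k l : 0 < u -> (k <= l)%N ->
  approxE u l `<=` approxE u k.
Proof.
move=> u0 /subnK <-; elim: (l - k)%N => // m IH.
by apply: subset_trans IH; exact: approxES.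
Qed.

(** A compactness argument over four digits: if each digit failed at some stage, all would fail at
    the largest of these stages, because the stages are nested. *)
Lemma bigcap_approxE_uncons (R : realType) (u x : R) : 0 < u ->
  (forall k, approxE u k x) ->
  exists d, d \in digits u /\ forall k, approxE u k (4 * x - d).
Proof.
move=> u0 xP; apply: contrapT => /forallNP nP.
have {}nP d : d \in digits u -> exists k, ~ approxE u k (4 * x - d).
  by move=> dd; apply/existsNP => H; apply: (nP d).
have [f fP] : exists f : R -> nat,
    forall d, d \in digits u -> ~ approxE u (f d) (4 * x - d).
  have /choice[f fP] d : exists k, d \in digits u -> ~ approxE u k (4 * x - d).
    by have [/nP[k ?]|/negP nd] := boolP (d \in digits u);
      [exists k|exists 0%N].
  by exists f.
have [d dd] := xP (\max_(d <- digits u) f d).+1.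
by move=> /(approxE_le u0 (leq_bigmax_seq d dd isT)); exact: fP.
Qed.

Lemma E_bigcap (R : realType) (u : R) : 0 < u -> E u = \bigcap_k approxE u k.
Proof.
move=> u0; apply/seteqP; split=> x.
  move=> Ex k _; elim: k x Ex => [|k IH] x Ex /=.
    by rewrite in_itv/=; exact: E_bound.
  by have [d dd /IH] := E_uncons Ex; exists d.
move=> xP; have {}xP k : approxE u k x by exact: xP.
(* [f] picks a digit that keeps the remainder in every stage; the orbit [t] of [x] under [g] then
   yields the whole expansion. The pair [(true, true)] is a dummy value. *)
have /choice[f fP] y : exists d : bool * bool, (forall k, approxE u k y) ->
    forall k, approxE u k (4 * y - (d.1%:R + u * d.2%:R)).
  have [yP|] := pselect (forall k, approxE u k y); last by exists (true, true).
  have [d [/digitsP[b [b' ->]] dP]] := bigcap_approxE_uncons u0 yP.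
  by exists (b, b').
pose g y := 4 * y - ((f y).1%:R + u * (f y).2%:R).
pose t n := iter n g x.
have tP n k : approxE u k (t n).
  elim: n k => [|n IH] k //=; exact: fP.
exists (fun n => (f (t n)).1), (fun n => (f (t n)).2).
set s := series _.
have st n : s n = x - 4^-1 ^+ n * t n.
  elim: n => [|n IH]; first by rewrite /s /series /= big_geq// expr0 mul1r subrr.
  by rewrite /s seriesSr -/s IH /= /g exprS; field.
have -> : s = (fun n => x - 4^-1 ^+ n * t n) by exact/funext.
rewrite -[X in _ --> X]subr0; apply: cvgB; first exact: cvg_cst.
apply/norm_cvg0P.
apply: (@squeeze_cvgr _ _ _ _ (cst 0) (fun n => maxE u * 4^-1 ^+ n)).
- near=> n; have := tP n 0%N; rewrite /= in_itv /= => /andP[t0 t1].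
  rewrite normr_ge0 /= ger0_norm ?mulr_ge0 ?exprn_ge0// ?invr_ge0//.
  by rewrite mulrC ler_wpM2r ?exprn_ge0.
- exact: cvg_cst.
rewrite -[X in _ --> X](mulr0 (maxE u)); apply: cvgMr; exact: cvg_expr4V.
Unshelve. all: by end_near. Qed.

Lemma closed_E (R : realType) (u : R) : 0 < u -> closed (E u).
Proof.
move=> u0; rewrite E_bigcap//; apply: closed_bigI => k _.
exact: closed_approxE.
Qed.

Lemma E0 (R : realType) (u : R) : E u 0.
Proof.
exists (fun=> false), (fun=> false).
rewrite (_ : series _ = cst 0); first exact: cvg_cst.
by apply/funext => n; rewrite /series /= big1// => i _; rewrite mulr0 add0r mul0r.
Qed.

(** The multiset S_k. Repetitions are kept, so that coinciding points count as overlapping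
    pieces. *)
Fixpoint pts (R : realType) (u : R) (k : nat) : seq R :=
  if k is k'.+1 then [seq 4 * s + d | s <- pts u k', d <- digits u] else [:: 0].

Lemma size_pts (R : realType) (u : R) k : size (pts u k) = (4 ^ k)%N.
Proof. by elim: k => [//|k IH]; rewrite [LHS]size_allpairs IH expnSr. Qed.

Lemma pts_ge0 (R : realType) (u : R) k s : 0 < u -> s \in pts u k -> 0 <= s.
Proof.
move=> u0; elim: k s => [|k IH] s; first by rewrite inE => /eqP ->.
move=> /allpairsP[[s' d] /= [/IH s0 dd ->]].
by have /andP[d0 _] := digits_itv u0 dd; lra.
Qed.

Lemma pts_le (R : realType) (u : R) k s : 0 < u -> s \in pts u k ->
  s <= maxE u * (4 ^+ k - 1).
Proof.
move=> u0; elim: k s => [|k IH] s; first by rewrite inE expr0 => /eqP ->; lra.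
move=> /allpairsP[[s' d] /= [/IH s0 dd ->]].
have /andP[_ d0] := digits_itv u0 dd.
have -> : maxE u * (4 ^+ k.+1 - 1) = 4 * (maxE u * (4 ^+ k - 1)) + (1 + u).
  by rewrite exprS /maxE; field.
by lra.
Qed.

Lemma E_ptsP (R : realType) (u x : R) k :
  E u x <-> exists2 s, s \in pts u k & E u (4 ^+ k * x - s).
Proof.
elim: k x => [|k IH] x.
  split=> [Ex|[s]]; last by rewrite inE => /eqP ->; rewrite expr0 mul1r subr0.
  by exists 0; rewrite ?inE// expr0 mul1r subr0.
split=> [/IH[s sk /E_uncons[d dd Ed]]|[_ /allpairsP[[s d] /= [sk dd ->]] Ed]].
  exists (4 * s + d); first by apply/allpairsP; exists (s, d).
  by move: Ed; congr E; rewrite exprS; ring.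
apply/IH; exists s => //; have := E_cons dd Ed; congr E.
by rewrite exprS; field.
Qed.

(** * Porosity of closed sets without interior *)

Lemma cvg_mul4_series (R : realType) (u x : R) (e e' : nat -> bool) :
  series (fun j => ((e j)%:R + 4 * u * (e' j)%:R) * 4^-1 ^+ j.+1) @ \oo --> x <->
  series (fun j => ((e j)%:R + u * (e' j.+1)%:R) * 4^-1 ^+ j.+1) @ \oo -->
    x - u * (e' 0%N)%:R.
Proof.
set a := series _; set b := series _.
(* The factor 4 moves the digits [e'] one place to the left: the first becomes an integer part, and
   the partial sums differ by one vanishing boundary term. *)
have ab n : a n = b n + u * (e' 0%N)%:R - u * (e' n)%:R * 4^-1 ^+ n.
  elim: n => [|n IH]; first by rewrite /a /b /series /= !big_geq// expr0; ring.
  by rewrite /a seriesSr -/a IH /b seriesSr -/b /= exprS; field.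
have c0 : (fun n => u * (e' n)%:R * 4^-1 ^+ n) @ \oo --> (0 : R).
  apply/norm_cvg0P.
  apply: (@squeeze_cvgr _ _ _ _ (cst 0) (fun n => `|u| * 4^-1 ^+ n)).
  - near=> n; rewrite normr_ge0 /= !normrM (ger0_norm (exprn_ge0 _ _)) ?invr_ge0//.
    rewrite ler_wpM2r ?exprn_ge0 ?invr_ge0// ler_piMr//.
    by case: (e' n); rewrite ?normr1 ?normr0.
  - exact: cvg_cst.
  rewrite -[X in _ --> X](mulr0 `|u|); apply: cvgMr; exact: cvg_expr4V.
split=> H.
  have -> : b = (fun n => a n - u * (e' 0%N)%:R + u * (e' n)%:R * 4^-1 ^+ n).
    by apply/funext => n; rewrite ab; ring.
  rewrite -[X in _ --> X]addr0; apply: cvgD => //.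
  by apply: cvgB => //; exact: cvg_cst.
have -> : a = (fun n => b n + u * (e' 0%N)%:R - u * (e' n)%:R * 4^-1 ^+ n).
  exact/funext.
have -> : x = x - u * (e' 0%N)%:R + u * (e' 0%N)%:R - 0 by ring.
by apply: cvgB => //; apply: cvgD => //; exact: cvg_cst.
Unshelve. all: by end_near. Qed.

(* 4 C = C `|` (C + 1) for the Cantor set C of the sums of distinct negative
   powers of 4, and E u = C + u C. *)
Lemma E_mul4 (R : realType) (u x : R) :
  E (4 * u) x <-> E u x \/ E u (x - u).
Proof.
split=> [[e [e' /cvg_mul4_series]]|].
  case: (e' 0%N); rewrite ?mulr1 ?mulr0 ?subr0 => ex; [right|left];
    by exists e, (e' \o S).
have H (b : bool) : E u (x - u * b%:R) -> E (4 * u) x.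
  move=> [e [e' ex]].
  pose f n := if n is m.+1 then e' m else b.
  by exists e, f; apply/(@cvg_mul4_series _ _ _ e f).
by case=> [Ex|Ex]; [apply: (H false)|apply: (H true)]; rewrite ?mulr0 ?mulr1 ?subr0.
Qed.

Definition has_itv (R : realType) (A : set R) : Prop :=
  exists a b : R, a < b /\ `[a, b] `<=` A.

Lemma has_itvS (R : realType) (A A' : set R) : A `<=` A' -> has_itv A -> has_itv A'.
Proof.
by move=> AA' [a [b [ab Aab]]]; exists a, b; split=> //; exact: subset_trans AA'.
Qed.

Definition porous (R : realType) (A : set R) : Prop :=
  forall l, 0 < l -> exists2 delta, 0 < delta &
    forall x, exists y, [/\ x <= y, y + delta <= x + l &
      forall z, y <= z <= y + delta -> ~ A z].

(** Finitely many cells of length [l / 2] cover [[0, B]], and each contains a gap of [A]; the least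
    gap size serves everywhere, as [A] is empty outside [[0, B]]. *)
Lemma porous_of_closed (R : realType) (A : set R) (B : R) : closed A ->
  A `<=` `[0, B] -> ~ has_itv A -> porous A.
Proof.
move=> cA AB nA l l0.
have gap a b : a < b -> exists y delta, [/\ 0 < delta, a <= y, y + delta <= b &
    forall z, y <= z <= y + delta -> ~ A z].
  move=> ab; have [z zab nAz] : exists2 z, a < z < b & ~ A z.
    (* The middle third is taken so that the missing point is strictly inside, with room for a gap
       to its right. *)
    pose a' := a + (b - a) / 3; pose b' := a + (b - a) / 3 * 2.
    have a'b' : a' < b' by rewrite /a' /b'; lra.
    apply: contrapT => H; apply: nA; exists a', b'; split=> // z /=.
    rewrite in_itv /= /a' /b' => zab; apply: contrapT => nAz; apply: H.
    by exists z => //; lra.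
  have : nbhs z (~` A) by apply: open_nbhs_nbhs; split=> //; exact: closed_openC.
  move=> /nbhs_ballP[r /= r0 rA].
  pose delta := Num.min (r / 2) ((b - z) / 2).
  have [d0 dr db] : [/\ 0 < delta, delta <= r / 2 & delta <= (b - z) / 2].
    by rewrite /delta lt_min !ge_min !lexx orbT; split=> //; apply/andP; split; lra.
  exists z, delta; split=> //; try lra.
  by move=> w wz; apply: rA; rewrite /ball /= ler0_norm; lra.
pose c := l / 2.
have c0 : 0 < c by rewrite /c; lra.
have c' : c = l / 2 by [].
have [delta [d0 dl dP]] : exists delta, [/\ 0 < delta, delta <= c &
  forall i : nat, (i%:R * c <= B + c) -> exists y, [/\ i%:R * c <= y,
    y + delta <= i.+1%:R * c & forall z, y <= z <= y + delta -> ~ A z]].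
  have H n : exists delta, [/\ 0 < delta, delta <= c &
    forall i, (i < n)%N -> exists y, [/\ i%:R * c <= y,
    y + delta <= i.+1%:R * c & forall z, y <= z <= y + delta -> ~ A z]].
    elim: n => [|n [dn [dn0 dnl dnP]]]; first by exists c; split.
    have [|y [e [e0 ay yb eP]]] := gap (n%:R * c) (n.+1%:R * c).
      by rewrite ltr_pM2r// ltr_nat.
    pose d := Num.min dn e.
    have [? ? ?] : [/\ 0 < d, d <= dn & d <= e].
      by rewrite /d lt_min !ge_min !lexx orbT; split=> //; apply/andP.
    exists d; split=> //; first lra.
    move=> i; rewrite ltnS leq_eqVlt => /predU1P[->|/dnP[w [w1 w2 w3]]].
      by exists y; split=> // [|z zy]; [lra|apply: eP; lra].
    by exists w; split=> // [|z zy]; [lra|apply: w3; lra].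
  have [delta [d0 dl dP]] := H (Num.bound ((B + c) / c)).
  exists delta; split=> // i ic; apply: dP.
  rewrite -(ltr_nat R); apply: le_lt_trans (archi_boundP _).
    by rewrite ler_pdivlMr.
  by rewrite divr_ge0//; [apply: le_trans ic; rewrite mulr_ge0// |]; exact: ltW.
exists delta => // x.
have [xneg|xpos] := ltP (x + delta) 0.
  exists x; split; [lra|lra|] => z zx /AB /=; rewrite in_itv /=; lra.
have [xB|xB] := ltP B x.
  exists x; split; [lra|lra|] => z zx /AB /=; rewrite in_itv /=; lra.
have [x0|x0] := ltP x 0.
  have [|y [y1 y2 y3]] := dP 0%N; first by rewrite mul0r; lra.
  by exists y; split=> //; lra.
have xc0 : 0 <= x / c by rewrite divr_ge0// ltW.
have /andP[t1 t2] := Num.Theory.truncn_itv xc0.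
move: t1 t2; rewrite ler_pdivlMr// ltr_pdivrMr// => t1 t2.
(* The cell following the one that contains [x] lies entirely in [[x, x + l]], because
   [l = 2 * c]. *)
have [|y [y1 y2 y3]] := dP (Num.truncn (x / c)).+1.
  by rewrite -addn1 natrD mulrDl; lra.
by exists y; split=> //; rewrite -addn2 natrD mulrDl in y2; lra.
Qed.

(** Gaps are nested: inside a gap of the first translate one looks for a common gap of the others.
    The final size depends only on the number of translates. *)
Lemma porous_shifts (R : realType) (A : set R) : porous A ->
  forall r l, 0 < l -> exists2 delta, 0 < delta &
    forall (ts : seq R) x, (size ts <= r)%N ->
    exists y, [/\ x <= y, y + delta <= x + l &
      forall z t, y <= z <= y + delta -> t \in ts -> ~ A (z - t)].
Proof.
move=> pA; elim=> [|r IH] l l0.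
  by exists l => // ts x; rewrite leqn0 => /eqP /size0nil ->; exists x; split.
have [d d0 dP] := pA l l0; have [e e0 eP] := IH d d0.
exists (Num.min d e); first by rewrite lt_min d0.
have [de dd] : Num.min d e <= e /\ Num.min d e <= d.
  by rewrite !ge_min !lexx orbT.
move=> [|t ts] x szts.
  by have [y [y1 y2 _]] := dP x; exists y; split=> //; lra.
have [y [y1 y2 yP]] := dP (x - t).
have [y' [y'1 y'2 y'P]] := eP ts (y + t) szts.
exists y'; split; [lra|lra|] => z t' zy; rewrite inE => /predU1P[->|t'ts].
  by apply: yP; lra.
by apply: y'P => //; lra.
Qed.

Lemma porous_E (R : realType) (u : R) : 0 < u -> ~ has_itv (E u) -> porous (E u).
Proof.
move=> u0; apply: (@porous_of_closed _ _ (maxE u)); first exact: closed_E.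
by move=> x /= /(E_bound u0); rewrite in_itv.
Qed.

(** If [E u] had no interval, its translates by 0 and [u] would share a gap inside any interval of
    their union [E (4 * u)]. *)
Lemma has_itv_mul4 (R : realType) (u : R) : 0 < u ->
  has_itv (E (4 * u)) <-> has_itv (E u).
Proof.
move=> u0; split; last by apply: has_itvS => x Ex; apply/E_mul4; left.
move=> [a [b [ab abE]]]; apply: contrapT => /(porous_E u0) pE.
have [|d d0 dP] := porous_shifts pE 2 (l := b - a); first by rewrite subr_gt0.
have [y [y1 y2 yP]] := dP [:: 0; u] a isT.
have /abE/E_mul4 : `[a, b]%classic y by rewrite /= in_itv /=; apply/andP; split; lra.
have yd : y <= y <= y + d by lra.
case=> [Ey|]; last by apply: (yP y u yd); rewrite !inE eqxx orbT.
by apply: (yP y 0 yd); rewrite ?inE ?eqxx ?subr0.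
Qed.

Lemma has_itv_mul4X (R : realType) (u : R) n : 0 < u ->
  has_itv (E (4 ^+ n * u)) <-> has_itv (E u).
Proof.
move=> u0; elim: n => [|n IH]; first by rewrite expr0 mul1r.
by rewrite exprS -mulrA has_itv_mul4// mulr_gt0// exprn_gt0.
Qed.

(** The level-[k] copy of [E u] through a given point has diameter at most [maxE u] / 4^k and
    contains a scaled copy of the interval, so interior points accumulate there. *)
Lemma E_closure_interior (R : realType) (u : R) : 0 < u -> has_itv (E u) ->
  E u = closure (interior (E u)).
Proof.
move=> u0 [a [b [ab abE]]]; apply/seteqP; split; last first.
  rewrite [X in _ `<=` X](_ : _ = closure (E u)).
    by apply: closure_subset; exact: interior_subset.
  exact/closure_id/closed_E.
move=> x Ex V /nbhs_ballP[r /= r0 rV].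
have [k kr] := @lt_geometric _ (maxE u) _ _ (quarter_itv R) r0.
rewrite mulrC in kr.
have e0 : 0 < 4^-1 ^+ k :> R by rewrite exprn_gt0// invr_gt0.
have e4 : 4 ^+ k * 4^-1 ^+ k = 1 :> R by rewrite -exprMn divff ?expr1n.
have [s sk Es] := (E_ptsP u x k).1 Ex.
pose z := (a + b) / 2.
have Ez : E u z by apply: abE; rewrite /= in_itv /= /z; apply/andP; split; lra.
exists (4^-1 ^+ k * (s + z)); split.
  apply/nbhs_ballP; exists (4^-1 ^+ k * ((b - a) / 2)) => /=.
    by rewrite mulr_gt0//; lra.
  move=> w; rewrite /ball /= => wP; apply/(E_ptsP _ _ k); exists s => //.
  apply: abE; rewrite /= in_itv /=.
  have : `|s + z - 4 ^+ k * w| < (b - a) / 2.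
    rewrite -(ltr_pM2l e0); apply: le_lt_trans wP.
    rewrite -{1}(ger0_norm (ltW e0)) -normrM mulrBr [X in _ - X]mulrA.
    by rewrite [_ * 4 ^+ k]mulrC e4 mul1r.
  by rewrite /z ltr_norml; lra.
apply: rV; rewrite /ball /=.
have -> : x - 4^-1 ^+ k * (s + z) = 4^-1 ^+ k * ((4 ^+ k * x - s) - z).
  by rewrite !mulrBr mulrA [_ * 4 ^+ k]mulrC e4; ring.
rewrite normrM ger0_norm ?(ltW e0)//; apply: le_lt_trans kr.
rewrite ler_pM2l//; have := E_bound u0 Es; have := E_bound u0 Ez.
by rewrite ler_norml; lra.
Qed.

(** * The interval case: complete residue systems modulo 4 *)

Lemma residue_digit (r s : nat) (N : int) : odd r -> odd s ->
  exists d, exists2 N1 : int, d \in [:: 0; s; 2 * r; s + 2 * r]%N &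
    N = d%:Z + 4 * N1.
Proof.
move=> or os.
have H : [\/ (4 %| N)%Z, (4 %| N - s%:Z)%Z, (4 %| N - (2 * r)%N%:Z)%Z
           | (4 %| N - (s + 2 * r)%N%:Z)%Z].
  have /dvdzP[n Nn] : (4 %| N - (N %% 4)%Z)%Z.
    by rewrite {1}(divz_eq N 4) addrK dvdz_mull.
  have := modz_ge0 N (isT : 4 != 0 :> int).
  have := ltz_pmod N (isT : 0 < 4 :> int).
  move: (N %% 4)%Z Nn => t Nn t4 t0.
  have [r' rE] : exists r', r = r'.*2.+1 by exists r./2; rewrite -[LHS]odd_double_half or.
  have [s' sE] : exists s', s = s'.*2.+1 by exists s./2; rewrite -[LHS]odd_double_half os.
  have s'E := odd_double_half s'.
  have dvdI (x y : int) : x = y * 4 -> (4 %| x)%Z by move=> ->; exact: dvdz_mull.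
  (* Modulo 4, [2 * r] is 2, while [s] and [s + 2 * r] are 1 and 3 in an order decided by the parity
     of [s'], that is, by [s] modulo 4. *)
  case: (odd s') s'E => s'E; have : [\/ t = 0, t = 1, t = 2 | t = 3] by
    (case: t t0 t4 {Nn} => [[|[|[|[|t]]]]|] // _ _;
      [constructor 1|constructor 2|constructor 3|constructor 4]).
  - case=> tE; [constructor 1|constructor 4|constructor 3|constructor 2].
    + by apply: (dvdI _ n); lia.
    + by apply: (dvdI _ (n - r'%:Z - s'./2%:Z - 1)); lia.
    + by apply: (dvdI _ (n - r'%:Z)); lia.
    + by apply: (dvdI _ (n - s'./2%:Z)); lia.
  - case=> tE; [constructor 1|constructor 2|constructor 3|constructor 4].
    + by apply: (dvdI _ n); lia.
    + by apply: (dvdI _ (n - s'./2%:Z)); lia.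
    + by apply: (dvdI _ (n - r'%:Z)); lia.
    + by apply: (dvdI _ (n - r'%:Z - s'./2%:Z)); lia.
case: H => /dvdzP[n Nn].
- by exists 0%N, n => //; lia.
- by exists s, n; [rewrite !inE eqxx orbT|lia].
- by exists (2 * r)%N, n; [rewrite !inE eqxx !orbT|lia].
- by exists (s + 2 * r)%N, n; [rewrite !inE eqxx !orbT|lia].
Qed.

(** Division with remainder by 4, iterated [k] times with remainders in the digit set times [s]. *)
Lemma pts_residues (R : realType) (r s k : nat) (N : int) : odd r -> odd s ->
  exists2 t, t \in pts ((2 * r)%:R / s%:R : R) k &
    exists m : int, N%:~R = s%:R * t + 4 ^+ k * m%:~R.
Proof.
move=> or os; have s0 : s%:R != 0 :> R by rewrite pnatr_eq0; case: s os.
elim: k N => [|k IH] N.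
  by exists 0; [rewrite inE|exists N; rewrite mulr0 add0r expr0 mul1r].
have [d [N1 dd NE]] := residue_digit N or os.
have [t tk [m N1E]] := IH N1.
exists (4 * t + d%:R / s%:R).
  apply/allpairsP; exists (t, d%:R / s%:R); split=> //=.
  move: dd; rewrite !inE => /or4P[] /eqP ->.
  - by rewrite mul0r eqxx.
  - by rewrite divff// eqxx orbT.
  - by rewrite eqxx !orbT.
  - by rewrite natrD mulrDl divff// eqxx !orbT.
exists m; rewrite NE intrD intrM N1E exprS.
by rewrite [d%:~R](_ : _ = d%:R)//; field.
Qed.

Lemma has_itv_complete (R : realType) (r s : nat) : odd r -> odd s ->
  has_itv (E ((2 * r)%:R / s%:R : R)).
Proof.
move=> or os; set u := _ / _.
have s0 : 0 < s%:R :> R by rewrite ltr0n; case: s os @u.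
have u0 : 0 < u by rewrite divr_gt0// ltr0n; case: r or @u => // r' _; lia.
apply: contrapT => /(porous_E u0) pE.
(* Only translates [m / s] with [|m| < M] can bring a point of [E u] close to [[0, 1]], so the
   finite list [ts] replaces (1/s)Z. *)
have [M MP] : exists M : nat, (s%:R * (maxE u + 2) < M%:R :> R).
  exists (Num.bound (s%:R * (maxE u + 2))); apply: archi_boundP.
  by rewrite mulr_ge0 ?(ltW s0)//; have := maxE_gt0 u0; lra.
pose ts := [seq (i%:R - M%:R) / s%:R : R | i <- iota 0 (2 * M)].
have [d d0 dP] := porous_shifts pE (size ts) (ltr01 : 0 < 1 :> R).
have [y [y0 yd yP]] := dP ts 0 (leqnn _).
have [k kd] : exists k, 4^-1 ^+ k < d / 2.
  have d2 : 0 < d / 2 by rewrite divr_gt0.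
  have [k kd] := @lt_geometric _ 1 _ _ (quarter_itv R) d2.
  by exists k; rewrite mul1r in kd.
have e0 : 0 < 4 ^+ k :> R by rewrite exprn_gt0.
(* [x] is the middle of a common gap, and N / (4^k s) is the grid point just below it, at distance
   under [d / 2]. Residues place that grid point in a translate of [E u], a contradiction. *)
pose x := y + d / 2.
pose N := Num.floor (4 ^+ k * s%:R * x).
have /andP[N1 N2] : N%:~R <= 4 ^+ k * s%:R * x < (N + 1)%:~R by exact: floor_itv.
have [t tk [m NE]] := pts_residues R k N or os; rewrite -/u in tk.
pose e := 4^-1 ^+ k * t.
have Ee : E u e.
  apply/(E_ptsP _ _ k); exists t => //.
  by rewrite /e mulrA -exprMn divff// expr1n mul1r subrr; exact: E0.
have eE : N%:~R = 4 ^+ k * s%:R * (e + m%:~R / s%:R).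
  rewrite NE /e exprVn; field; rewrite gt_eqF//= expf_neq0//.
have xe : 0 <= x - (e + m%:~R / s%:R) < d / 2.
  apply/andP; split; first by rewrite subr_ge0 -(ler_pM2l (mulr_gt0 e0 s0)) -eE.
  apply: le_lt_trans kd; rewrite exprVn -(ler_pM2l e0) divff ?gt_eqF//.
  have s1 : 1 <= s%:R :> R by rewrite ler1n -(ltr0n R).
  set w := x - _; have : 4 ^+ k * s%:R * w <= 1.
    by rewrite /w mulrBr -eE; move: N2; rewrite intrD; lra.
  have w0 : 0 <= w by rewrite /w subr_ge0 -(ler_pM2l (mulr_gt0 e0 s0)) -eE.
  by apply: le_trans; rewrite -mulrA ler_pM2l// ler_peMl.
apply: (yP (e + m%:~R / s%:R) (m%:~R / s%:R)).
- by move: xe; rewrite /x; lra.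
- have mb : `|m%:~R| < M%:R :> R.
    have : `|m%:~R / s%:R| <= maxE u + 2 :> R.
      by have := E_bound u0 Ee; move: xe; rewrite /x ler_norml; lra.
    rewrite normrM normfV (ger0_norm (ltW s0)) ler_pdivrMr// mulrC => H.
    exact: le_lt_trans MP.
  have [n nE] : exists2 n : nat, (n < 2 * M)%N & m = n%:Z - M%:Z.
    have {}mb : `|m| < M%:Z.
      by rewrite -(ltr_int R) intr_norm.
    by exists (absz (m + M%:Z)); move: mb; clear; lia.
  move=> ->; apply/mapP; exists n; first by rewrite mem_iota.
  by rewrite intrB.
by rewrite addrK.
Qed.

(** * Sets with uniformly thin covers *)

Definition itv_cover (R : realType) (c : seq R) (l : R) : set R :=
  [set z | exists2 x, x \in c & x <= z <= x + l].

Lemma itv_cover_cons (R : realType) (x : R) c l :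
  itv_cover (x :: c) l = `[x, x + l]%classic `|` itv_cover c l.
Proof.
apply/seteqP; split=> z /=; rewrite in_itv /=.
  by move=> [y]; rewrite inE => /predU1P[->|yc]; [left|right; exists y].
by case=> [xz|[y yc yz]]; [exists x|exists y]; rewrite ?inE ?eqxx ?yc ?orbT.
Qed.

Lemma itv_cover0 (R : realType) (l : R) : itv_cover [::] l = set0.
Proof. by apply/seteqP; split=> z [] x. Qed.

Lemma measurable_itv_cover (R : realType) (c : seq R) l : measurable (itv_cover c l).
Proof.
elim: c => [|x c IH]; first by rewrite itv_cover0.
by rewrite itv_cover_cons; apply: measurableU => //; exact: measurable_itv.
Qed.

Lemma lebesgue_itv_cover (R : realType) (c : seq R) l : 0 <= l ->
  (lebesgue_measure (itv_cover c l) <= ((size c)%:R * l)%:E)%E.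
Proof.
move=> l0; elim: c => [|x c IH]; first by rewrite itv_cover0 measure0 mul0r.
rewrite itv_cover_cons; apply: le_trans (measureU2 lebesgue_measure
  (measurable_itv `[x, x + l]) (measurable_itv_cover c l)) _.
rewrite /= -addn1 natrD mulrDl addrC EFinD; apply: leeD => //.
rewrite lebesgue_measure_itv /= lte_fin; case: ifP => _.
  by rewrite -EFinD lee_fin; lra.
by rewrite lee_fin mul1r.
Qed.

(* A set with such covers has dimension at most log K / log (K + 1). *)
Definition thin (R : realType) (A : set R) : Prop :=
  exists K (B : R), [/\ (0 < K)%N, 0 < B & forall n, exists2 c : seq R,
    (size c <= K ^ n)%N & A `<=` itv_cover c (B * K.+1%:R^-1 ^+ n)].

(** The covers have total length at most B (K / (K + 1))^n, which tends to 0. *)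
Lemma thin_lebesgue0 (R : realType) (A : set R) : measurable A -> thin A ->
  lebesgue_measure A = 0%E.
Proof.
move=> mA [K [B [K0 B0 H]]]; apply/eqP; rewrite eq_le measure_ge0 andbT.
apply/lee_addgt0Pr => e e0; rewrite add0e.
have [|n nP] := @lt_geometric _ B (K%:R / K.+1%:R) e _ e0.
  by rewrite divr_ge0//= ltr_pdivrMr// mul1r ltr_nat.
have [c sc Ac] := H n; set l := B * _ in Ac.
have l0 : 0 <= l by rewrite mulr_ge0 ?(ltW B0)// exprn_ge0.
apply: le_trans (le_trans (lebesgue_itv_cover c l0) _).
  by apply: le_measure; rewrite ?inE//; exact: measurable_itv_cover.
rewrite lee_fin; apply: le_trans (ltW nP).
apply: (@le_trans _ _ ((K ^ n)%:R * l)); first by rewrite ler_wpM2r// ler_nat.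
by rewrite /l natrX expr_div_n exprVn; lra.
Qed.

Lemma diam_itv_cover1 (R : realType) (x l : R) : 0 <= l ->
  (0 <= diam `[x, (x + l)%R]%classic <= l%:E)%E.
Proof.
move=> l0; apply/andP; split.
  apply: ereal_sup_ubound; exists (x, x); last by rewrite subrr normr0.
  by split; rewrite /= in_itv /= lexx; lra.
apply: ge_ereal_sup => _ [[y z] [/= yx zx] <-]; rewrite lee_fin.
by move: yx zx; rewrite /= !in_itv /= ler_norml; lra.
Qed.

Lemma diam_pow_ge0 (R : realType) (s : R) (U : set R) : (0 <= diam_pow s U)%E.
Proof. by rewrite /diam_pow; case: ifP => // _; exact: poweR_ge0. Qed.

Lemma hausdorff_pre_le (R : realType) (s d l : R) (c : seq R) (A : set R) :
  0 <= s -> 0 <= l <= d -> A `<=` itv_cover c l ->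
  (hausdorff_pre s d A <= ((size c)%:R * l `^ s)%:E)%E.
Proof.
move=> s0 /andP[l0 ld] Ac; apply: ge_ereal_inf.
(* The finite cover is padded with empty sets: their [diam_pow] is 0, and their diameter is [-oo],
   the supremum of the empty set. *)
pose U k : set R := if (k < size c)%N then `[c`_k, c`_k + l]%classic else set0.
exists (\sum_(k <oo) diam_pow s (U k))%E.
  exists U => //; split=> [z /Ac[x xc xz]|k].
    exists (index x c) => //; rewrite /U index_mem xc nth_index//= in_itv//=.
  rewrite /U; case: ifP => _.
    have /andP[_] := diam_itv_cover1 (c`_k) l0.
    by move=> /le_trans; apply; rewrite lee_fin.
  rewrite /diam (_ : [set _ | _ in _] = set0) ?ereal_sup0 ?leNye//.
  by apply/seteqP; split=> r //= [[y z] []].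
rewrite (nneseries_split 0 (size c)); last by move=> *; exact: diam_pow_ge0.
rewrite eseries0 ?adde0; last first.
  by move=> k; rewrite add0n => ck _; rewrite /U ltnNge ck /= /diam_pow eqxx.
rewrite add0n big_mkord.
apply: (@le_trans _ _ (\sum_(k < size c) (l `^ s)%:E)%E).
  apply: lee_sum => k _; rewrite /diam_pow; case: ifP => _.
    by rewrite lee_fin powR_ge0.
  rewrite /U ltn_ord -poweR_EFin.
  have /andP[d0 d1] := diam_itv_cover1 (c`_k) l0.
  apply: gt0_ler_poweR => //; rewrite in_itv /= ?leey ?andbT// lee_fin.
by rewrite sumEFin lee_fin sumr_const card_ord mulr_natl.
Qed.

Lemma thin_hausdorff_dim (R : realType) (A : set R) : thin A ->
  (hausdorff_dim A < 1)%E.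
Proof.
move=> [K [B [K0 B0 H]]].
have Kpos : 1 <= K%:R :> R by rewrite ler1n.
have w1 : 1 < K.+1%:R :> R by rewrite ltr1n ltnS.
have wE : K.+1%:R = K%:R + 1 :> R by rewrite -natr1.
set w : R := K.+1%:R in w1 wE H.
have w0 : 0 < w by lra.
(* The exponent solves w^s = K + 1/2 with w = K + 1. As K + 1/2 < w, it is below 1; as K < K + 1/2,
   the sums K^n l^s decay geometrically. *)
pose s := ln (K%:R + 2^-1) / ln w.
have s0 : 0 <= s by rewrite divr_ge0// ln_ge0//; lra.
have s1 : s < 1.
  by rewrite ltr_pdivrMr ?ln_gt0// mul1r ltr_ln ?posrE; lra.
have ws : w `^ s = K%:R + 2^-1.
  by rewrite /powR gt_eqF// /s divfK ?gt_eqF ?ln_gt0// lnK// posrE; lra.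
apply: (@le_lt_trans _ _ s%:E); last by rewrite lte_fin.
apply: ereal_inf_lbound; exists s => //; split=> //.
apply/eqP; rewrite eq_le; apply/andP; split; last first.
  apply: ereal_sup_ge; exists (hausdorff_pre s 1 A); first by exists 1 => //=.
  apply: le_ereal_inf_tmp => _ [U _ <-].
  by apply: nneseries_ge0 => n _ _; exact: diam_pow_ge0.
apply: ge_ereal_sup => _ [d /= d0 <-].
apply/lee_addgt0Pr => e e0; rewrite add0e.
have winv : 0 <= w^-1 < 1 by rewrite invr_ge0 ltW//= invf_lt1.
have q01 : 0 <= (K%:R : R) / (K%:R + 2^-1) < 1.
  by rewrite divr_ge0 /= ?ltr_pdivrMr; lra.
have [n0 n0P] := @lt_geometric _ B _ _ winv d0.
have [n1 n1P] := @lt_geometric _ (B `^ s) _ _ q01 e0.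
pose n := maxn n0 n1.
have [c sc Ac] := H n.
set l := B * _ in Ac.
have l0 : 0 <= l by rewrite mulr_ge0 ?(ltW B0)// exprn_ge0//; case/andP: winv.
have ld : l <= d.
  apply: le_trans (ltW n0P); case/andP: winv => wi0 wi1.
  by rewrite ler_pM2l// ler_wiXn2l ?leq_maxl ?(ltW wi1).
apply: le_trans (hausdorff_pre_le s0 _ Ac) _; first by rewrite l0 ld.
rewrite lee_fin; apply: le_trans (ltW n1P).
apply: (@le_trans _ _ ((K ^ n)%:R * l `^ s)).
  by rewrite ler_wpM2r ?powR_ge0// ler_nat.
have -> : l `^ s = B `^ s * (K%:R + 2^-1) ^- n.
  rewrite /l powRM ?exprn_ge0 ?(ltW B0)//; last by case/andP: winv.
  by rewrite exprVn -powR_invn ?ltW// powRAC ws powR_invn//; lra.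
rewrite mulrCA natrX -exprVn -exprMn ler_wpM2l ?powR_ge0//.
by case/andP: q01 => q0 q1; rewrite ler_wiXn2l ?leq_maxr ?(ltW q1).
Qed.

(** The window holds every [s] for which [s + E u] meets [[x, x + maxE u]]. Only distinct translates
    matter for finding a common gap, hence [undup]. *)
Definition sparse_pts (R : realType) (u : R) (r : nat) : Prop :=
  forall k x, (size (undup
    [seq s <- pts u k | (x - maxE u <= s <= x + maxE u)%R]) <= r)%N.

(** At every scale 4^k, the blow-up of [E u] is locally a union of at most [r] translates, so it has
    gaps of one size [d]. Hence, among [M] equal subcells of a cell, one misses [E u], and [M - 1]
    are kept at each step. *)
Lemma thin_E (R : realType) (u : R) r : 0 < u -> porous (E u) -> sparse_pts u r ->
  thin (E u).
Proof.
move=> u0 pE bu; have B0 := maxE_gt0 u0.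
have [d d0 dP] := porous_shifts pE r B0.
have [m md] := @lt_geometric _ (2 * maxE u) _ _ (quarter_itv R) d0.
set M := (4 ^ m)%N; have M0 : 0 < M%:R :> R by rewrite ltr0n expn_gt0.
pose c := maxE u / M%:R.
have c0 : 0 < c by rewrite divr_gt0.
(* A gap twice as long as a subcell contains a complete subcell, namely the one after the subcell of
   its left end [y]. *)
have cd : 2 * c <= d.
  by apply: ltW; move: md; rewrite exprVn -natrX /c; lra.
have gap k x : exists j, (j < M)%N /\
    forall z, x + j%:R * (c * 4^-1 ^+ k) <= z <= x + j.+1%:R * (c * 4^-1 ^+ k) -> ~ E u z.
  have e0 : 0 < 4 ^+ k :> R by rewrite exprn_gt0.
  set X := 4 ^+ k * x.
  have [y [y1 y2 yP]] := dP _ X (bu k X).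
  have yc0 : 0 <= (y - X) / c by rewrite divr_ge0 ?(ltW c0)//; lra.
  have /andP[t1 t2] := Num.Theory.truncn_itv yc0.
  set j := Num.truncn _ in t1 t2.
  move: t1 t2; rewrite ler_pdivlMr// ltr_pdivrMr// -natr1 mulrDl mul1r => t1 t2.
  have maxEE : maxE u = M%:R * c by rewrite /c; field; rewrite gt_eqF.
  exists j.+1; split.
    rewrite -(ltr_nat R) -(ltr_pM2r c0) -maxEE -natr1 mulrDl mul1r; lra.
  move=> z zP /(E_ptsP _ _ k)[s sk Es].
  have zy : y <= 4 ^+ k * z <= y + d.
    have /andP[z1 z2] := zP.
    rewrite -(ler_pM2l e0) mulrDr -/X in z1; rewrite -(ler_pM2l e0) mulrDr -/X in z2.
    have H (i : R) : 4 ^+ k * (i * (c * 4^-1 ^+ k)) = i * c.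
      by rewrite exprVn; field; rewrite expf_neq0.
    by move: z1 z2; rewrite !H -(@natr1 _ j.+1) -(@natr1 _ j); lra.
  apply: (yP _ s zy) => //; rewrite mem_undup mem_filter sk andbT.
  by have := E_bound u0 Es; lra.
exists M.-1, (maxE u).
have M1 : (1 < M)%N.
  rewrite -(ltr_nat R) -(ltr_pM2r c0) mul1r.
  have -> : M%:R * c = maxE u by rewrite /c; field; rewrite gt_eqF.
  have [y [? ? _]] := dP [::] 0 isT; lra.
have MK : M.-1.+1 = M by rewrite prednK// ltnW.
split=> //; first by rewrite -ltnS MK.
rewrite MK; elim=> [|n [s ss sE]].
  exists [:: 0] => // x /(E_bound u0) xb; exists 0; rewrite ?inE//.
  by rewrite expr0 mulr1 add0r.
have /choice[j jP] := gap (m * n)%N.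
set w := c * 4^-1 ^+ (m * n).
have wE : w = maxE u * M%:R^-1 ^+ n.+1.
  by rewrite /w /c exprS mulrA /M natrX exprM !exprVn.
have wE' : M%:R * w = maxE u * M%:R^-1 ^+ n.
  by rewrite wE exprS; field; rewrite gt_eqF.
have w0 : 0 < w by rewrite mulr_gt0// exprn_gt0// invr_gt0.
(* [bump (j x)] enumerates the indices below [M] while skipping the empty subcell [j x]. *)
exists [seq x + (bump (j x) i)%:R * w | x <- s, i <- iota 0 M.-1].
  by rewrite size_allpairs size_iota expnSr leq_mul.
move=> z Ez; have [x xs xz] := sE z Ez; rewrite -wE' in xz; rewrite -wE.
have [i iM /andP[iz1 iz2]] : exists2 i, (i < M)%N &
    x + i%:R * w <= z <= x + i.+1%:R * w.
  have [zl|zl] := ltP z (x + M%:R * w); last first.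
    exists M.-1; first by rewrite MK.
    rewrite MK; apply/andP; split; last lra.
    by apply: le_trans zl; rewrite lerD2l ler_pM2r// ler_nat leq_pred.
  have zw0 : 0 <= (z - x) / w by rewrite divr_ge0 ?(ltW w0)//; lra.
  have /andP[t1 t2] := Num.Theory.truncn_itv zw0.
  set i := Num.truncn _ in t1 t2.
  move: t1 t2; rewrite ler_pdivlMr// ltr_pdivrMr// => t1 t2.
  exists i; last by lra.
  by rewrite -(ltr_nat R) -(ltr_pM2r w0); lra.
have [jM jE] := jP x.
have ij : i != j x.
  by apply/eqP => ijx; apply: (jE z) => //; rewrite -ijx iz1 iz2.
exists (x + i%:R * w); last by rewrite iz1; move: iz2; rewrite -natr1; lra.
apply/allpairsP; exists (x, unbump (j x) i); split=> //=.
  rewrite mem_iota add0n /= /unbump; move: ij iM jM; move: (j x) (M) => j' M'; clear.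
  by case: ltnP; lia.
by rewrite unbumpK// inE.
Qed.

(** * Bounded local counts of the points of S_k *)

Lemma pts_rational (R : realType) (p q k : nat) (s : R) : (0 < q)%N ->
  s \in pts (p%:R / q%:R) k -> exists n : nat, s = n%:R / q%:R.
Proof.
move=> q0; have q0' : q%:R != 0 :> R by rewrite pnatr_eq0 -lt0n.
elim: k s => [|k IH] s; first by rewrite inE => /eqP ->; exists 0%N; rewrite mul0r.
move=> /allpairsP[[t d] /= [/IH[n ->] dd ->]].
have [n' ->] : exists n' : nat, d = n'%:R / q%:R.
  move: dd; rewrite !inE => /or4P[] /eqP ->.
  - by exists 0%N; rewrite mul0r.
  - by exists q; rewrite divff.
  - by exists p.
  - by exists (q + p)%N; rewrite natrD mulrDl divff.
by exists (4 * n + n')%N; rewrite natrD natrM; field.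
Qed.

Lemma sparse_pts_rational (R : realType) (p q : nat) : (0 < p)%N -> (0 < q)%N ->
  exists r, sparse_pts (p%:R / q%:R : R) r.
Proof.
move=> p0 q0; set u := _ / _.
have q0' : 0 < q%:R :> R by rewrite ltr0n.
have u0 : 0 < u by rewrite divr_gt0// ltr0n.
have B0 := maxE_gt0 u0.
set b := Num.bound (2 * q%:R * maxE u).
have bP : 2 * q%:R * maxE u < b%:R.
  by apply: archi_boundP; apply: mulr_ge0 (ltW B0); rewrite mulr_ge0 ?ler0n.
exists b.+1 => k x; set ts := undup _.
pose N0 := Num.truncn (q%:R * (x - maxE u)).
(* The points lie in (1/q)Z, and [b.+1] consecutive lattice points starting at [N0] exhaust the
   window. *)
rewrite -[X in (_ <= X)%N](size_iota N0) -(size_map (fun n => n%:R / q%:R : R)).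
apply: uniq_leq_size; first exact: undup_uniq.
move=> s; rewrite mem_undup mem_filter => /andP[/andP[s1 s2] /(pts_rational q0)[n sn]].
apply/mapP; exists n => //; rewrite mem_iota.
have nq : q%:R * s = n%:R by rewrite sn; field; rewrite gt_eqF.
rewrite -(ler_pM2l q0') nq in s1; rewrite -(ler_pM2l q0') nq in s2.
apply/andP; split.
  by rewrite /N0 Num.Theory.truncn_le_nat; apply: le_lt_trans s1 _; rewrite ltr_nat.
rewrite -(ltr_nat R) natrD -(@natr1 _ b).
suff : q%:R * (x - maxE u) < N0%:R + 1.
  by move: bP s2; rewrite mulrBr mulrDr; lra.
by rewrite natr1 /N0 Num.Theory.truncnS_gt.
Qed.

(** The pushforward scaled by [a] agrees with Lebesgue measure on half-open intervals, hence
    everywhere by uniqueness. *)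
Lemma lebesgue_affine (R : realType) (a b : R) (A : set R) : 0 < a -> measurable A ->
  measurable [set x | A (a * x + b)] /\
  lebesgue_measure A = (a%:E * lebesgue_measure [set x | A (a * x + b)%R])%E.
Proof.
move=> a0 mA; pose f (x : measurableTypeR R) : measurableTypeR R := a * x + b.
have mf : measurable_fun setT f.
  apply: continuous_measurable_fun => x; apply: cvgD; last exact: cvg_cst.
  by apply: cvgMr; exact: cvg_id.
split; first by rewrite -[X in measurable X]setTI; exact: mf.
have := @lebesgue_measure_unique R
  (mscale (NngNum (ltW a0)) (pushforward lebesgue_measure f)).
move=> /(_ mf) lu; apply: lu mA => X [[p q] /= pq <-].
rewrite /mscale /= /pushforward (_ : f @^-1` _ = `](p - b) / a, (q - b) / a]%classic).
  rewrite !lebesgue_measure_itv /= !lte_fin ltr_pM2r ?invr_gt0// ltrD2r.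
  case: ifP => _; last by rewrite mule0.
  by rewrite -!EFinD -EFinM; congr (_%:E); field; rewrite gt_eqF.
apply/seteqP; split=> x /=; rewrite !in_itv /= ltr_pdivrMr// ler_pdivlMr// /f; lra.
Qed.

(** * Translates of a set of finite measure *)

Lemma lebesgue_shift (R : realType) (s : R) (A : set R) : measurable A ->
  measurable [set x | A (x - s)] /\
  lebesgue_measure [set x | A (x - s)] = lebesgue_measure A.
Proof.
move=> mA; have [m1 m2] := lebesgue_affine (- s) (ltr01 : 0 < 1 :> R) mA.
have e : [set x | A (x - s)] = [set x | A (1 * x + - s)].
  by apply/seteqP; split=> x /=; rewrite mul1r.
by rewrite e m2 mul1e.
Qed.

Lemma measurable_E (R : realType) (u : R) : 0 < u -> measurable (E u : set R).
Proof. by move=> u0; apply: closed_measurable; exact: closed_E. Qed.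

Lemma lebesgue_E_fin (R : realType) (u : R) : 0 < u ->
  lebesgue_measure (E u) \is a fin_num.
Proof.
move=> u0; rewrite ge0_fin_numE ?measure_ge0//.
apply: (@le_lt_trans _ _ (lebesgue_measure `[0, maxE u]%classic)).
  apply: le_measure; rewrite ?inE; [exact: measurable_E|exact: measurable_itv|].
  by move=> x /(E_bound u0); rewrite /= in_itv.
by rewrite lebesgue_measure_itv /=; case: ifP => _; rewrite ?ltry// -EFinB ltry.
Qed.

Definition shifts_union (R : realType) (A : set R) (ss : seq R) : set R :=
  [set x | exists2 s, s \in ss & A (x - s)].

Lemma shifts_union_cons (R : realType) (A : set R) s ss :
  shifts_union A (s :: ss) = [set x | A (x - s)] `|` shifts_union A ss.
Proof.
apply/seteqP; split=> x /=.
  by move=> [t]; rewrite inE => /predU1P[->|tss Ax]; [left|right; exists t].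
by case=> [Ax|[t tss Ax]]; [exists s|exists t]; rewrite ?inE ?eqxx ?tss ?orbT.
Qed.

Lemma shifts_union_nil (R : realType) (A : set R) : shifts_union A [::] = set0.
Proof. by apply/seteqP; split=> x // []. Qed.

(** The points covered at least twice, repeated shifts counted separately. *)
Fixpoint shifts_overlap (R : realType) (A : set R) (ss : seq R) : set R :=
  if ss is s :: ss' then
    shifts_overlap A ss' `|` ([set x | A (x - s)] `&` shifts_union A ss')
  else set0.

Lemma measurable_shifts_union (R : realType) (A : set R) (ss : seq R) :
  measurable A -> measurable (shifts_union A ss).
Proof.
move=> mA; elim: ss => [|s ss IH]; first by rewrite shifts_union_nil.
by rewrite shifts_union_cons; apply: measurableU => //; have [] := lebesgue_shift s mA.
Qed.

Lemma measurable_shifts_overlap (R : realType) (A : set R) (ss : seq R) :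
  measurable A -> measurable (shifts_overlap A ss).
Proof.
move=> mA; elim: ss => [|s ss IH] //=; apply: measurableU => //.
by apply: measurableI; [have [] := lebesgue_shift s mA|exact: measurable_shifts_union].
Qed.

Lemma lebesgue_shifts_overlap (R : realType) (A : set R) (ss : seq R) :
  measurable A -> lebesgue_measure A \is a fin_num ->
  (lebesgue_measure (shifts_union A ss) + lebesgue_measure (shifts_overlap A ss) <=
   (size ss)%:R%:E * lebesgue_measure A)%E.
Proof.
move=> mA fA; elim: ss => [|s ss IH].
  by rewrite shifts_union_nil /= !measure0 mul0e adde0.
rewrite shifts_union_cons [size _]/=.
have [ms es] := lebesgue_shift s mA.
set S := [set x | A (x - s)] in ms es *.
set U := shifts_union A ss in IH *.
have mU : measurable U := measurable_shifts_union ss mA.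
have mI : measurable (S `&` U) by exact: measurableI.
have mO := measurable_shifts_overlap ss mA.
apply: (@le_trans _ _ (lebesgue_measure (S `|` U) +
    (lebesgue_measure (shifts_overlap A ss) + lebesgue_measure (S `&` U)))%E).
  by apply: leeD => //; exact: measureU2.
have fS : (lebesgue_measure S < +oo)%E by rewrite es -ge0_fin_numE ?measure_ge0.
have fI : lebesgue_measure (S `&` U) \is a fin_num.
  rewrite ge0_fin_numE ?measure_ge0//; apply: le_lt_trans fS.
  by apply: le_measure; rewrite ?inE//; exact: subIsetl.
have -> : lebesgue_measure (S `|` U) =
    (lebesgue_measure S + lebesgue_measure U - lebesgue_measure (S `&` U))%E.
  by rewrite measureUfinl.
rewrite addeA addeAC subeK// es -addeA -natr1 EFinD muleDl ?fin_num_adde_defl//.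
by rewrite addeC mul1e; apply: leeD.
Qed.

Lemma lebesgue_shifts_union (R : realType) (A : set R) (ss : seq R) :
  measurable A -> lebesgue_measure A \is a fin_num ->
  (lebesgue_measure (shifts_union A ss) <= (size ss)%:R%:E * lebesgue_measure A)%E.
Proof.
move=> mA fA; apply: le_trans (lebesgue_shifts_overlap ss mA fA).
by rewrite leeDl// measure_ge0.
Qed.

Lemma lebesgue_blowup_E (R : realType) (u : R) k : 0 < u ->
  lebesgue_measure (shifts_union (E u) (pts u k)) =
  ((4 ^ k)%:R%:E * lebesgue_measure (E u))%E.
Proof.
move=> u0; have mE := measurable_E u0.
have e0 : 0 < 4 ^+ k :> R by rewrite exprn_gt0.
have [_ ->] := lebesgue_affine 0 e0 (measurable_shifts_union (pts u k) mE).
rewrite natrX; congr (_ * lebesgue_measure _)%E.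
apply/seteqP; split=> x; rewrite /shifts_union /= addr0; first by move/E_ptsP.
by move=> H; exact/(E_ptsP u x k).
Qed.

(** The union of the translates already has measure 4^k |E|, the sum of the measures of its pieces,
    which leaves nothing for the overlap. *)
Lemma overlap_E0 (R : realType) (u : R) k : 0 < u ->
  lebesgue_measure (shifts_overlap (E u) (pts u k)) = 0%E.
Proof.
move=> u0; have fE := lebesgue_E_fin u0.
have := lebesgue_shifts_overlap (pts u k) (measurable_E u0) fE.
rewrite lebesgue_blowup_E// size_pts -[X in (_ <= X)%E]adde0.
rewrite leeD2lE ?fin_numM// => H.
by apply/eqP; rewrite eq_le H measure_ge0.
Qed.

(** The blow-up has the full measure 4^k [m], of which the far translates account for at most [m]
    each. The [c] near ones must supply [c * m] inside an interval of length [3 * maxE u]. *)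
Lemma sparse_pts_positive (R : realType) (u : R) : 0 < u ->
  lebesgue_measure (E u) != 0%E -> exists r, sparse_pts u r.
Proof.
move=> u0 mu0; have mE := measurable_E u0; have fE := lebesgue_E_fin u0.
have B0 := maxE_gt0 u0.
set m := fine (lebesgue_measure (E u)).
have mEq : lebesgue_measure (E u) = m%:E by rewrite fineK.
have m0 : 0 < m.
  by rewrite -lte_fin -mEq lt_neqAle eq_sym mu0 measure_ge0.
exists (Num.bound (3 * maxE u / m)) => k x.
apply: leq_trans (size_undup _) _; rewrite -(ler_nat R).
set P := fun s => _ <= s <= _.
apply: le_trans (ltW (archi_boundP _)); last first.
  exact: divr_ge0 (mulr_ge0 (ler0n _ _) (ltW B0)) (ltW m0).
rewrite ler_pdivlMr//; set c := size _.
have cP : c = count P (pts u k) by rewrite /c size_filter.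
have := lebesgue_blowup_E k u0.
have -> : shifts_union (E u) (pts u k) =
    shifts_union (E u) [seq s <- pts u k | P s] `|`
    shifts_union (E u) [seq s <- pts u k | predC P s].
  apply/seteqP; split=> z.
    move=> [s sk Es]; have [Ps|Ps] := boolP (P s); [left|right]; exists s => //;
      by rewrite mem_filter /= ?Ps ?(negbTE Ps).
  by move=> [] [s]; rewrite mem_filter => /andP[_ sk] Es; exists s.
move=> eq; have := measureU2 lebesgue_measure
  (measurable_shifts_union [seq s <- pts u k | P s] mE)
  (measurable_shifts_union [seq s <- pts u k | predC P s] mE).
move: eq => /= ->.
have H1 : (lebesgue_measure (shifts_union (E u) [seq s <- pts u k | P s]) <=
    (3 * maxE u)%:E)%E.
  apply: (@le_trans _ _ (lebesgue_measure `[x - maxE u, x + 2 * maxE u]%classic)).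
    apply: le_measure; rewrite ?inE.
    - exact: measurable_shifts_union.
    - exact: measurable_itv.
    move=> z [s]; rewrite mem_filter => /andP[/andP[s1 s2] _] /(E_bound u0) /andP[z1 z2].
    by rewrite /= in_itv /=; lra.
  rewrite lebesgue_measure_itv /= lte_fin ifT; last lra.
  by rewrite -EFinD lee_fin; lra.
have H2 := lebesgue_shifts_union [seq s <- pts u k | predC P s] mE fE.
move=> /le_trans /(_ (leeD H1 H2)).
rewrite mEq -!EFinM -EFinD lee_fin size_filter.
have -> : (4 ^ k)%:R = c%:R + (count (predC P) (pts u k))%:R :> R.
  by rewrite cP -natrD count_predC size_pts.
by rewrite mulrDl lerD2r.
Qed.

(** * The signed telescoping argument *)

Definition bdiff (R : realType) (t : R) (F : R -> R) : R -> R :=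
  fun x => F x - F (x - t).

Lemma sum_digits (R : realType) (u : R) (F : R -> R) :
  \sum_(d <- digits u) F d = \sum_(c : bool) \sum_(b : bool) F (b%:R + u * c%:R).
Proof.
rewrite !big_bool /= !big_cons big_nil !mulr0 !mulr1 !addr0 !add0r.
by ring.
Qed.

Lemma sum_ptsS (R : realType) (u : R) n (F : R -> R) :
  \sum_(s <- pts u n.+1) F s =
  \sum_(s <- pts u n) \sum_(d <- digits u) F (4 * s + d).
Proof. exact: big_allpairs_dep. Qed.

Lemma pts_sumD (R : realType) (u : R) n k (F : R -> R) :
  \sum_(s <- pts u (n + k)) F s =
  \sum_(s <- pts u k) \sum_(r <- pts u n) F (4 ^+ n * s + r).
Proof.
elim: n F => [|n IH] F.
  by apply: eq_bigr => s _; rewrite big_seq1 expr0 mul1r addr0.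
rewrite addSn sum_ptsS (IH (fun s => \sum_(d <- digits u) F (4 * s + d))).
apply: eq_bigr => s _; rewrite sum_ptsS.
by apply: eq_bigr => r _; apply: eq_bigr => d _; congr F; rewrite exprS; ring.
Qed.

(* The polynomial identity (1 + z^2)(1 + z)(1 - z) = 1 - z^4, with z the
   translation by t / 2. *)
Lemma bdiff_telescope (R : realType) (t y : R) (F : R -> R) :
  \sum_(b : bool) \sum_(b' : bool) bdiff (t / 2) F (y - t * b%:R - t * b'%:R / 2) =
  bdiff (2 * t) F y.
Proof.
rewrite !big_bool /bdiff /= !mulr0 !mulr1 !mul0r !subr0.
have -> : y - t - t / 2 - t / 2 = y - 2 * t by field.
have -> : y - t / 2 - t / 2 = y - t by field.
have -> : y - t - t / 2 = y - t / 2 - t by ring.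
by ring.
Qed.

(** Digits have the form b + u c, so the sum splits and [bdiff_telescope] applies once in the
    direction [t] and once in the direction [t * u]. *)
Lemma bdiff_telescope2 (R : realType) (u t y : R) (F : R -> R) :
  \sum_(d <- digits u) \sum_(d' <- digits u)
    bdiff (t / 2) (bdiff (t * u / 2) F) (y - t * d - t * d' / 2) =
  bdiff (2 * t) (bdiff (2 * (t * u)) F) y.
Proof.
rewrite sum_digits; under eq_bigr => c _ do under eq_bigr => b _ do rewrite sum_digits.
under eq_bigr => c _ do rewrite exchange_big /=.
have H (c c' : bool) : \sum_(b : bool) \sum_(b' : bool)
    bdiff (t / 2) (bdiff (t * u / 2) F)
      (y - t * (b%:R + u * c%:R) - t * (b'%:R + u * c'%:R) / 2) =
    bdiff (t * u / 2) F (y - t * u * c%:R - t * u * c'%:R / 2) -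
    bdiff (t * u / 2) F (y - 2 * t - t * u * c%:R - t * u * c'%:R / 2).
  rewrite (_ : y - 2 * t - _ - _ = y - t * u * c%:R - t * u * c'%:R / 2 - 2 * t);
    last by ring.
  rewrite -[RHS]/(bdiff (2 * t) (bdiff (t * u / 2) F) _) -bdiff_telescope.
  by apply: eq_bigr => b _; apply: eq_bigr => b' _; congr bdiff; field.
under eq_bigr => c _ do under eq_bigr => c' _ do rewrite H.
under eq_bigr => c _ do rewrite big_split sumrN /=.
by rewrite big_split sumrN /= 2!bdiff_telescope.
Qed.

(** Summing over one level of digits of both S_n and S_n / 2 multiplies the two steps of the
    difference by 4. *)
Lemma bdiff_pts (R : realType) (u t x : R) n (F : R -> R) :
  \sum_(r <- pts u n) \sum_(g <- pts u n)
    bdiff (t / 2) (bdiff (t * u / 2) F) (x - t * r - t * g / 2) =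
  bdiff (4 ^+ n * t / 2) (bdiff (4 ^+ n * t * u / 2) F) x.
Proof.
elim: n t x => [|n IH] t x.
  by rewrite !big_seq1 mulr0 mul0r !subr0 expr0 !mul1r.
rewrite sum_ptsS.
have -> : 4 ^+ n.+1 * t = 4 ^+ n * (4 * t) by rewrite exprSr mulrA.
rewrite -IH; apply: eq_bigr => r _.
under eq_bigr => d _ do rewrite sum_ptsS.
rewrite exchange_big /=; apply: eq_bigr => g _.
rewrite (_ : 4 * t / 2 = 2 * t); last by field.
rewrite (_ : 4 * t * u / 2 = 2 * (t * u)); last by field.
rewrite -bdiff_telescope2; apply: eq_bigr => d _; apply: eq_bigr => d' _.
by congr bdiff; field.
Qed.

Lemma bdiff_sum (R : realType) (I : Type) (ss : seq I) (t x : R) (F : I -> R -> R) :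
  bdiff t (fun z => \sum_(s <- ss) F s z) x = \sum_(s <- ss) bdiff t (F s) x.
Proof. by rewrite /bdiff sumrB. Qed.

Lemma shifts_count (R : realType) (A : set R) (ss : seq R) (x : R) :
  shifts_union A ss x -> ~ shifts_overlap A ss x ->
  \sum_(s <- ss) (`[< A (x - s) >]%:R : R) = 1.
Proof.
elim: ss => [|s ss IH]; first by rewrite shifts_union_nil.
rewrite shifts_union_cons /= big_cons => Ux Ox.
have nO : ~ shifts_overlap A ss x by move=> ?; apply: Ox; left.
have [/asboolP As|/asboolP nAs] := boolP `[< A (x - s) >].
  have nU : ~ shifts_union A ss x by move=> ?; apply: Ox; right.
  rewrite big_seq big1 ?addr0// => t tss; case: asboolP => // At.
  by exfalso; apply: nU; exists t.
by rewrite add0r; apply: IH => //; case: Ux.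
Qed.

(** Serves to make finitely many almost-everywhere identities hold at one and the same point. *)
Lemma ex_notin_shifts (R : realType) (A Z : set R) (ts : seq R) :
  measurable A -> measurable Z -> lebesgue_measure Z = 0%E ->
  lebesgue_measure A != 0%E ->
  exists2 y, A y & forall t, t \in ts -> ~ Z (y - t).
Proof.
move=> mA mZ Z0 A0; apply: contrapT => H; move/eqP: A0; apply.
apply/eqP; rewrite eq_le measure_ge0 andbT.
have fZ : lebesgue_measure Z \is a fin_num by rewrite Z0.
have := lebesgue_shifts_union ts mZ fZ; rewrite Z0 mule0; apply: le_trans.
apply: le_measure; rewrite ?inE//; first exact: measurable_shifts_union.
move=> y Ay; apply: contrapT => nU; apply: H; exists y => // t tts Zt.
by apply: nU; exists t.
Qed.

Lemma seq_gap (R : realType) (V : seq R) (v0 : R) :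
  exists2 e, 0 < e & forall v, v \in V -> v != v0 -> e <= `|v - v0|.
Proof.
elim: V => [|v V [e e0 eP]]; first by exists 1.
have [vv|vv] := eqVneq v v0.
  by exists e => // w; rewrite inE => /predU1P[->|/eP//]; rewrite vv eqxx.
exists (Num.min e `|v - v0|); first by rewrite lt_min e0 normr_gt0 subr_eq0.
move=> w; rewrite inE => /predU1P[->|/eP H] wv; rewrite ge_min ?lexx ?orbT//.
by rewrite H.
Qed.

Lemma no_itv_E (R : realType) (u : R) : 0 < u ->
  (forall k s s', s \in pts u k -> s' \in pts u k ->
     s + 1 / 2 != s' /\ s + u / 2 != s') -> ~ has_itv (E u).
Proof.
move=> u0 parity [a [b [ab abE]]].
have B0 := maxE_gt0 u0; have mE := measurable_E u0.
have lE : lebesgue_measure (E u) != 0%E.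
  apply/eqP => lE0; have : (lebesgue_measure `[a, b]%classic <= lebesgue_measure (E u))%E.
    by apply: le_measure; rewrite ?inE//; exact: measurable_itv.
  by rewrite lE0 lebesgue_measure_itv /= lte_fin ab -EFinD lee_fin; lra.
pose eta := (b - a) / 2; have eta0 : 0 < eta by rewrite /eta; lra.
pose x0 := (a + b) / 2.
(* Blown up by 4^k, the interval has half-length above [1 + u + maxE u], which leaves room around
   [v0] for all translations in [ts]. *)
have [k kP] := @lt_geometric _ (1 + u + maxE u) _ _ (quarter_itv R) eta0.
have ek : 0 < 4 ^+ k :> R by rewrite exprn_gt0.
have {}kP : 1 + u + maxE u < 4 ^+ k * eta.
  by move: kP; rewrite exprVn ltr_pdivrMr// mulrC.
have Ex0 : E u x0 by apply: abE; rewrite /= in_itv /= /x0; apply/andP; split; lra.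
have [v0 v0k /(E_bound u0) v0P] := (E_ptsP u x0 k).1 Ex0.
have window w : v0 - (1 + u) <= w <= v0 + maxE u -> E u (4 ^- k * w).
  move=> wP; apply: abE; rewrite /= in_itv /= mulrC ler_pdivlMr// ler_pdivrMr//.
  have -> : a = x0 - eta by rewrite /x0 /eta; field.
  have -> : b = x0 + eta by rewrite /x0 /eta; field.
  by apply/andP; split; lra.
(* [V] lists the positions that enter the second difference with a minus sign; by [parity] none
   equals [v0], and [n] is chosen so that [E u + N v] misses [E u + N v0] for [v] in [V]. *)
pose V := [seq s + 1 / 2 | s <- pts u k] ++ [seq s + u / 2 | s <- pts u k].
have [e e0 eP] := seq_gap V v0.
have [n nP] := @lt_geometric _ (maxE u) _ _ (quarter_itv R) e0.
pose N : R := 4 ^+ n; have N0 : 0 < N by rewrite exprn_gt0.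
have N1 : 1 <= N by rewrite exprn_ege1// ler1n.
have {}nP : maxE u < N * e.
  by move: nP; rewrite exprVn ltr_pdivrMr// mulrC.
have fE := lebesgue_E_fin u0.
(* All translations at which [G] gets evaluated: S_n / 2 plus the four corners of the second
   difference. *)
pose ts := [seq g / 2 + c | g <- pts u n, c <- [:: 0; u / 2; 1 / 2; 1 / 2 + u / 2]].
have [m1 m2] := lebesgue_shift (N * v0) mE.
have [|||y Ey yP] := @ex_notin_shifts _ _ (shifts_overlap (E u) (pts u (n + k))) ts m1.
- exact: measurable_shifts_overlap.
- exact: overlap_E0.
- by rewrite m2.
pose F x : R := `[< E u x >]%:R.
pose G z := \sum_(s <- pts u (n + k)) F (z - s).
have yb := E_bound u0 Ey.
have G1 t : t \in ts -> G (y - t) = 1.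
  move=> tts; apply: shifts_count; last exact: yP.
  have tb : 0 <= t <= N * (1 + u).
    move: tts => /allpairsP[[g c] /= [gn cc ->]].
    have g0 := pts_ge0 u0 gn; have := pts_le u0 gn; rewrite -/N => gb.
    have cb : 0 <= c <= (1 + u) / 2.
      by move: cc; rewrite !inE => /or4P[] /eqP ->; apply/andP; split; lra.
    have : maxE u * (N - 1) = (N * (1 + u) - (1 + u)) / 3 by rewrite /maxE; field.
    have : 1 * (1 + u) <= N * (1 + u) by rewrite ler_pM2r//; lra.
    by lra.
  have /window/(E_ptsP _ _ (n + k))[s sk Es] :
      v0 - (1 + u) <= N^-1 * (y - t) <= v0 + maxE u.
    rewrite mulrC ler_pdivlMr// ler_pdivrMr//.
    have : 1 * maxE u <= N * maxE u by rewrite ler_pM2r.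
    by lra.
  exists s => //; move: Es; congr E; rewrite exprD -/N; field.
  by rewrite !gt_eqF.
have DG0 g : g \in pts u n ->
    bdiff (1 / 2) (bdiff (u / 2) G) (y - g / 2) = 0.
  move=> gn; rewrite /bdiff.
  have H c : c \in [:: 0; u / 2; 1 / 2; 1 / 2 + u / 2] -> G (y - (g / 2 + c)) = 1.
    by move=> cc; apply: G1; apply/allpairsP; exists (g, c).
  have -> : y - g / 2 = y - (g / 2 + 0) by ring.
  rewrite H ?inE ?eqxx//.
  have -> : y - (g / 2 + 0) - 1 / 2 - u / 2 = y - (g / 2 + (1 / 2 + u / 2)) by ring.
  have -> : y - (g / 2 + 0) - u / 2 = y - (g / 2 + u / 2) by ring.
  have -> : y - (g / 2 + 0) - 1 / 2 = y - (g / 2 + 1 / 2) by ring.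
  by rewrite !H ?inE ?eqxx ?orbT//; ring.
have DGE g : bdiff (1 / 2) (bdiff (u / 2) G) (y - g / 2) =
    \sum_(s <- pts u k) \sum_(r <- pts u n)
      bdiff (1 / 2) (bdiff (u / 2) F) (y - N * s - 1 * r - 1 * g / 2).
  have -> : bdiff (u / 2) G = fun z => \sum_(s <- pts u (n + k)) bdiff (u / 2) F (z - s).
    apply/funext => z; rewrite /G bdiff_sum; apply: eq_bigr => s _.
    by rewrite /bdiff; congr (_ - F _); ring.
  rewrite bdiff_sum pts_sumD; apply: eq_bigr => s _; apply: eq_bigr => r _.
  rewrite /bdiff -/N; congr (F _ - F _ - (F _ - F _)); ring.
(* This sum vanishes because [G] is 1 at all the points involved; regrouped by [bdiff_pts], it is
   shown to be positive. *)
have : \sum_(g <- pts u n) bdiff (1 / 2) (bdiff (u / 2) G) (y - g / 2) = 0.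
  by rewrite big_seq big1.
under eq_bigr => g _ do rewrite DGE.
rewrite exchange_big /=.
under eq_bigr => s _ do rewrite exchange_big /=.
have sumE s : \sum_(r <- pts u n) \sum_(g <- pts u n)
   bdiff (1 / 2) (bdiff (u / 2) F) (y - N * s - 1 * r - 1 * g / 2) =
   bdiff (N / 2) (bdiff (N * u / 2) F) (y - N * s).
  by have := bdiff_pts u 1 (y - N * s) n F; rewrite -/N mulr1 (mul1r u).
under eq_bigr => s _ do rewrite sumE.
have F0 x : 0 <= F x by rewrite /F ler0n.
have kinkV v : v \in V -> v != v0 -> F (y - N * v) = 0.
  move=> vV vv; rewrite /F; case: asboolP => // /(E_bound u0) yv.
  have := eP v vV vv.
  rewrite -(ler_pM2l N0) -[X in _ <= X * _](ger0_norm (ltW N0)) -normrM.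
  have : `|N * (v - v0)| <= maxE u by rewrite ler_norml; lra.
  by lra.
have kink s : s \in pts u k ->
    F (y - N * s) <= bdiff (N / 2) (bdiff (N * u / 2) F) (y - N * s).
  move=> sk; have [h1 h2] := parity k s v0 sk v0k.
  have e1 : F (y - N * (s + 1 / 2)) = 0.
    by apply: kinkV h1; rewrite mem_cat; apply/orP; left; apply/mapP; exists s.
  have e2 : F (y - N * (s + u / 2)) = 0.
    by apply: kinkV h2; rewrite mem_cat; apply/orP; right; apply/mapP; exists s.
  rewrite /bdiff.
  have -> : y - N * s - N * u / 2 = y - N * (s + u / 2) by ring.
  rewrite [X in F _ - F _ - (F X - _)](_ : _ = y - N * (s + 1 / 2)); last by ring.
  (* Both negative terms vanish, and the remaining corner enters with a plus sign. *)
  rewrite e1 e2; have := F0 (y - N * s - N / 2 - N * u / 2); lra.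
move=> sum0.
have : 0 < \sum_(s <- pts u k) bdiff (N / 2) (bdiff (N * u / 2) F) (y - N * s).
  apply: (@lt_le_trans _ _ (\sum_(s <- pts u k) F (y - N * s))); last first.
    by rewrite big_seq [leRHS]big_seq; apply: ler_sum.
  rewrite (big_rem v0)//= ltr_wpDr ?sumr_ge0//.
  by rewrite /F; case: asboolP.
by rewrite sum0 ltxx.
Qed.

(** * The three cases *)

Lemma four_decomp (n : nat) : (0 < n)%N -> exists v m,
  [/\ n = (4 ^ v * m)%N, last_digit4 n = (m %% 4)%N & ~~ (4 %| m)%N].
Proof.
move=> n0; pose v := four_val n.
have vn : (4 ^ v %| n)%N.
  have : (0 < #|[pred j : 'I_n | (4 ^ j %| n)%N]|)%N.
    by apply/card_gt0P; exists (Ordinal n0); rewrite inE /= dvd1n.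
  by case/(eq_bigmax_cond (fun j : 'I_n => j : nat)) => j jn vE; rewrite /v /four_val vE.
exists v, (n %/ 4 ^ v)%N; split=> //; first by rewrite mulnC divnK.
apply/negP => /dvdnP[m mE].
have vSn : (4 ^ v.+1 %| n)%N.
  by apply/dvdnP; exists m; rewrite -(divnK vn) mE expnS mulnA.
(* Since 4^(v+1) <= n, the exponent [v.+1] is within the range of the maximum defining [four_val],
   and contradicts it. *)
have vlt : (v.+1 < n)%N by apply: leq_trans (dvdn_leq n0 vSn); exact: ltn_expl.
have := @leq_bigmax_cond _ (fun j : 'I_n => (4 ^ j %| n)%N) (fun j => j : nat)
  (Ordinal vlt) vSn.
by rewrite -/(four_val n) -/v ltnn.
Qed.

Lemma has_itv_strip4 (R : realType) (a b p q : nat) : (0 < p)%N -> (0 < q)%N ->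
  has_itv (E ((4 ^ a * p)%:R / (4 ^ b * q)%:R : R)) <-> has_itv (E (p%:R / q%:R : R)).
Proof.
move=> p0 q0.
have pos x y : (0 < x)%N -> (0 < y)%N -> 0 < x%:R / y%:R :> R.
  by move=> x0 y0; rewrite divr_gt0 ?ltr0n.
rewrite -(has_itv_mul4X b) ?pos ?muln_gt0 ?expn_gt0//.
rewrite -[X in _ <-> X](has_itv_mul4X a) ?pos//.
have -> // : 4 ^+ b * ((4 ^ a * p)%:R / (4 ^ b * q)%:R) = 4 ^+ a * (p%:R / q%:R) :> R.
rewrite !natrM !natrX; field.
by rewrite expf_neq0 ?pnatr_eq0 -?lt0n ?q0.
Qed.

Lemma has_itv_odd_sum (R : realType) (p q : nat) : (0 < p)%N -> (0 < q)%N ->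
  odd (last_digit4 p + last_digit4 q) -> has_itv (E (p%:R / q%:R : R)).
Proof.
move=> /four_decomp[a [p' [-> -> p'4]]] /four_decomp[b [q' [-> -> q'4]]] pq.
have p'0 : (0 < p')%N by case: p' p'4 pq => //; rewrite dvdn0.
have q'0 : (0 < q')%N by case: q' q'4 pq => //; rewrite dvdn0.
apply/has_itv_strip4 => //.
rewrite oddD !odd_mod// in pq.
have half m : ~~ (4 %| m)%N -> ~~ odd m -> exists2 m', odd m' & m = (2 * m')%N.
  move=> m4 /even_halfK mE; exists m./2; last by rewrite mul2n mE.
  apply: contraNT m4 => /even_halfK mE'.
  by rewrite -mE -mE' -!muln2 -mulnA dvdn_mull.
have [po|pe] := boolP (odd p').
  rewrite po /= in pq; have [s os qE] := half _ q'4 pq.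
  have s0 : s%:R != 0 :> R by rewrite pnatr_eq0; case: s os {qE}.
  have u0 : 0 < p'%:R / q'%:R :> R by rewrite divr_gt0 ?ltr0n.
  (* With q' = 2 s, one more factor 4 turns p' / (2 s) into 2 p' / s, the form with an even
     numerator. *)
  apply: (has_itv_mul4 u0).1.
  have := has_itv_complete R po os; congr (has_itv (E _)).
  by rewrite qE !natrM; field.
have [r or pE] := half _ p'4 pe.
by rewrite pE; apply: has_itv_complete => //; rewrite (negbTE pe) in pq.
Qed.

(** Parity: n / q + m / (2 q) = n' / q gives 2 n + m = 2 n', impossible for [m] odd. The cases m = q
    and m = p are the shifts 1/2 and u/2. *)
Lemma no_itv_odd (R : realType) (p q : nat) : odd p -> odd q ->
  ~ has_itv (E (p%:R / q%:R : R)).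
Proof.
move=> op oq.
have p0 : (0 < p)%N by case: p op.
have q0 : (0 < q)%N by case: q oq.
have q0' : q%:R != 0 :> R by rewrite pnatr_eq0 -lt0n.
have H (n n' m : nat) : odd m -> n%:R / q%:R + m%:R / q%:R / 2 != n'%:R / q%:R :> R.
  move=> om; apply/eqP => e.
  have : (n.*2 + m)%:R = n'.*2%:R :> R.
    rewrite -!muln2 natrD !natrM.
    have -> : m%:R = q%:R * 2 * (m%:R / q%:R / 2) :> R by field.
    by rewrite (_ : _ / q%:R / 2 = n'%:R / q%:R - n%:R / q%:R);
      [field|rewrite -e; ring].
  move=> /eqP; rewrite eqr_nat => /eqP /(congr1 odd).
  by rewrite oddD !odd_double om.
apply: no_itv_E; first by rewrite divr_gt0 ?ltr0n.
move=> k s s' /(pts_rational q0)[n ->] /(pts_rational q0)[n' ->]; split; last exact: H.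
by have := H n n' q oq; rewrite divff.
Qed.

Lemma pts_lin (R : realType) (u : R) k s : s \in pts u k ->
  exists a b : int, s = a%:~R + u * b%:~R.
Proof.
elim: k s => [|k IH] s.
  by rewrite inE => /eqP ->; exists 0, 0; rewrite mulr0 addr0.
move=> /allpairsP[[t d] /= [/IH[a [b ->]] /digitsP[c [c' ->]] ->]].
exists (4 * a + c%:R), (4 * b + c'%:R).
by rewrite !intrD !intrM; case: c; case: c'; rewrite /=; ring.
Qed.

(** Points of S_k are integer combinations of 1 and [u], which are independent over the rationals,
    so a shift by 1/2 or u/2 would force 1/2 to be an integer. *)
Lemma no_itv_irrational (R : realType) (u : R) : 0 < u -> irrational u ->
  ~ has_itv (E u).
Proof.
move=> u0 iu.
have H (a b : rat) : ratr a + u * ratr b = 0 -> a = 0 /\ b = 0.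
  have [->|b0] := eqVneq b 0.
    by rewrite rmorph0 mulr0 addr0 => /eqP; rewrite fmorph_eq0 => /eqP.
  move=> /eqP; rewrite addr_eq0 => /eqP e; exfalso; apply: iu.
  exists (- a / b) => //; rewrite fmorph_div rmorphN /= e opprK mulfK//.
  by rewrite fmorph_eq0.
apply: no_itv_E => // k s s' /pts_lin[a [b ->]] /pts_lin[a' [b' ->]].
have odd_int (x y : int) : (x%:Q + 2^-1 - y%:Q)%R != 0.
  apply/eqP => e; have : ((x - y) * 2 + 1)%:~R = 0 :> rat.
    by rewrite intrD intrM intrB; lra.
  by move/eqP; rewrite intr_eq0; lia.
split; apply/eqP => e.
  have [] := H (a%:Q + 2^-1 - a'%:Q) (b%:Q - b'%:Q).
    rewrite !rmorphB rmorphD /= fmorphV !ratr_int rmorph_nat; lra.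
  by move/eqP; rewrite (negbTE (odd_int _ _)).
have [] := H (a%:Q - a'%:Q) (b%:Q + 2^-1 - b'%:Q).
  rewrite !rmorphB rmorphD /= fmorphV !ratr_int rmorph_nat.
  by rewrite mulrBr mulrDr; lra.
by move=> _ /eqP; rewrite (negbTE (odd_int _ _)).
Qed.

Theorem theorem1 (R : realType) (u : R) (hu : 0 < u) :
  [/\ (forall p q : nat, (0 < p)%N -> (0 < q)%N -> u = p%:R / q%:R ->
         odd (last_digit4 p + last_digit4 q) ->
         (exists a b : R, a < b /\ `[a, b] `<=` E u) /\
         E u = closure (interior (E u))),
      (forall p q : nat, (0 < p)%N -> (0 < q)%N -> u = p%:R / q%:R ->
         odd (last_digit4 p) -> odd (last_digit4 q) ->
         lebesgue_measure (E u) = 0%E /\ (hausdorff_dim (E u) < 1)%E) &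
      (irrational u -> lebesgue_measure (E u) = 0%E)].
Proof.
split.
- move=> p q p0 q0 uE pq.
  have hE : has_itv (E u) by rewrite uE; exact: has_itv_odd_sum.
  by split; [exact: hE|exact: E_closure_interior].
- move=> p q p0 q0 uE op oq.
  have nE : ~ has_itv (E u).
    rewrite uE; move: op oq.
    have [a [p' [-> -> p'4]]] := four_decomp p0.
    have [b [q' [-> -> q'4]]] := four_decomp q0.
    rewrite !odd_mod// => op oq /has_itv_strip4 H.
    by apply: (@no_itv_odd R p' q') => //; apply: H; [case: (p') op|case: (q') oq].
  have [r sp] := @sparse_pts_rational R p q p0 q0; rewrite -uE in sp.
  have tE : thin (E u) := thin_E hu (porous_E hu nE) sp.
  by split; [apply: thin_lebesgue0 => //; exact: measurable_E
            |exact: thin_hausdorff_dim].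
(* Without a lattice, the local count is bounded by assuming positive measure; the resulting
   thinness refutes that assumption. *)
move=> iu; apply: contrapT => /eqP mu0.
have [r sp] := sparse_pts_positive hu mu0.
move/eqP: mu0; apply; apply: thin_lebesgue0; first exact: measurable_E.
exact: thin_E hu (porous_E hu (no_itv_irrational hu iu)) sp.
Qed.
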